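(* If the family of sets $\mathcal{M}(\preccurlyeq)=\{\{y\in\mathcal{S}:y\preccurlyeq x\}:x\in\mathcal{S}\}$ is a determining class, then the partial quantile indices $\tau_x$, $x\in\mathcal{S}$, and the probabilities of comparison $p_x$, $x\in\mathcal{S}$, uniquely determine the probability distribution of $X$.
   Context: $X$ is a random variable on $(\Omega,\mathcal{A},P)$ with values in an arbitrary (measurable) set $\mathcal{S}$ with a partial order $\preccurlyeq$ ($x\succcurlyeq y$ means $y\preccurlyeq x$); the events $\{X\succcurlyeq x\}$, $\{X\preccurlyeq x\}$ are measurable for all $x$. $\mathcal{C}(x)=\{y\in\mathcal{S}:y\succcurlyeq x\text{ or }y\preccurlyeq x\}$; $p_x=P(X\in\mathcal{C}(x))$; $\tau_x=P(X\preccurlyeq x\mid X\in\mathcal{C}(x))$. A family of sets $\mathcal{E}$ is a determining class if for any two probability measures $\mu,\nu$ such that $\mu(E)=\nu(E)$ for all $E\in\mathcal{E}$ we have $\mu=\nu$. *)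

(* Defs.v *)
From HB Require Import structures.
From mathcomp Require Import all_boot all_order all_algebra.
From mathcomp Require Import all_classical all_reals all_analysis.

Set Implicit Arguments.
Unset Strict Implicit.
Unset Printing Implicit Defensive.

Local Open Scope classical_set_scope.
Local Open Scope ring_scope.

Definition partial_order (S : Type) (le : rel S) : Prop :=
  [/\ reflexive le, antisymmetric le & transitive le].

Definition below (S : Type) (le : rel S) (x : S) : set S := [set y | le y x].

Definition above (S : Type) (le : rel S) (x : S) : set S := [set y | le x y].

Definition comparables (S : Type) (le : rel S) (x : S) : set S :=
  [set y | le x y \/ le y x].

Definition lower_sets (S : Type) (le : rel S) : set (set S) :=
  [set below le x | x in [set: S]].

(* Library measures are functions on all of [set S], constrained only on the
   measurable sets: equality of measures is therefore equality on measurable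
   sets, and nonmeasurable members of [E] would carry no information. *)
Definition determining_class (R : realType) (d : measure_display)
    (S : measurableType d) (E : set (set S)) : Prop :=
  forall mu nu : probability S R,
    (forall A, E A -> mu A = nu A) ->
    forall A, measurable A -> mu A = nu A.

(* P(A | B), equal to 0 by the convention r / 0 = 0 when P B = 0. *)
Definition cond_prob (R : realType) (d : measure_display)
    (T : measurableType d) (P : probability T R) (A B : set T) : R :=
  fine (P (A `&` B)) / fine (P B).

Definition comparison_prob (R : realType) (d d' : measure_display)
    (T : measurableType d) (S : measurableType d') (le : rel S)
    (P : probability T R) (X : {RV P >-> S}) (x : S) : R :=
  fine (P (X @^-1` comparables le x)).

(* When the comparison probability at x is 0, the value 0 of the index carries no
   information beyond it. *)
Definition partial_quantile_index (R : realType) (d d' : measure_display)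
    (T : measurableType d) (S : measurableType d') (le : rel S)
    (P : probability T R) (X : {RV P >-> S}) (x : S) : R :=
  cond_prob P (X @^-1` below le x) (X @^-1` comparables le x).

Definition comparison_events_measurable (R : realType)
    (d d' : measure_display) (T : measurableType d) (S : measurableType d')
    (le : rel S) (P : probability T R) (X : {RV P >-> S}) : Prop :=
  forall x : S, measurable (X @^-1` above le x) /\
                measurable (X @^-1` below le x).

(* Main.v *)
Require Import Defs.
From HB Require Import structures.
From mathcomp Require Import all_boot all_order all_algebra.
From mathcomp Require Import all_classical all_reals all_analysis.

Import Order.TTheory GRing.Theory Num.Theory.

Local Open Scope classical_set_scope.
Local Open Scope ring_scope.

(** Every point below [x] is comparable to [x], so the chain rule for conditional probability gives
    P(X ≼ x) = τ_x p_x; this is [prob_below_comparison]. Equal indices and comparison probabilities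
    thus force the two laws to agree on every lower set, and a determining class extends the
    agreement to all measurable sets. *)

(* Both sides vanish when [comparison_prob le X x = 0], so the convention
   [r / 0 = 0] is harmless. *)
Lemma prob_below_comparison (R : realType) (d dS : measure_display)
    (T : measurableType d) (S : measurableType dS) (le : rel S)
    (P : probability T R) (X : {RV P >-> S}) (x : S) :
  comparison_events_measurable le X ->
  P (X @^-1` below le x) =
    (partial_quantile_index le X x * comparison_prob le X x)%:E.
Proof.
move=> /(_ x)[mabove mbelow].
have mcomp : measurable (X @^-1` comparables le x).
  by have -> : X @^-1` comparables le x =
       X @^-1` above le x `|` X @^-1` below le x by []; exact: measurableU.
have sub : X @^-1` below le x `<=` X @^-1` comparables le x by move=> t; right.
rewrite /partial_quantile_index /comparison_prob /cond_prob.
rewrite (setIidl sub) -[LHS]fineK ?fin_num_measure//; congr EFin.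
have [p0|p0] := eqVneq (fine (P (X @^-1` comparables le x))) 0; last first.
  by rewrite divfK.
(* Here the quotient cannot be cancelled; instead, monotonicity squeezes the probability of the
   smaller event [below] between 0 and p_x = 0. *)
rewrite p0 mulr0; apply/le_anti/andP; split; last exact: fine_ge0.
rewrite -p0; apply: fine_le; rewrite ?fin_num_measure//.
by apply: le_measure => //; rewrite inE.
Qed.

Theorem theorem5 (R : realType) (dS : measure_display)
    (S : measurableType dS) (le : rel S)
    (le_po : partial_order le)
    (detM : determining_class R (lower_sets le))
    (d1 : measure_display) (T1 : measurableType d1) (P1 : probability T1 R)
    (X1 : {RV P1 >-> S}) (mX1 : comparison_events_measurable le X1)
    (d2 : measure_display) (T2 : measurableType d2) (P2 : probability T2 R)
    (X2 : {RV P2 >-> S}) (mX2 : comparison_events_measurable le X2)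
    (eq_tau : forall x : S,
      partial_quantile_index le X1 x = partial_quantile_index le X2 x)
    (eq_p : forall x : S, comparison_prob le X1 x = comparison_prob le X2 x) :
  forall A : set S, measurable A ->
    distribution P1 X1 A = distribution P2 X2 A.
Proof.
apply: (detM (distribution P1 X1) (distribution P2 X2)) => _ [x _ <-].
(* [distribution] is the pushforward measure, so its value on a lower set is by conversion the
   probability of the preimage. *)
change (P1 (X1 @^-1` below le x) = P2 (X2 @^-1` below le x)).
by rewrite !prob_below_comparison// eq_tau eq_p.
Qed.
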